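(* Let $\mathcal H$ be a complex separable Hilbert space and let $F,\hat F\subset\mathcal H$ be closed real linear subspaces. (a) Let $K\subset\mathcal H$ be a standard subspace. Then $H:=\overline{K+F}$ is separating if and only if $\mathbb C[H'^{\perp_{\mathbb R}}\cap K']\cap\mathbb C[K]=\{0\}$. Moreover, $H'^{\perp_{\mathbb R}}\cap K'=\overline{E_{K'}(iF)}$ and, therefore, $K'=H'\oplus\overline{E_{K'}(iF)}$. (b) Let $H\subset\mathcal H$ be a standard subspace. Then $K:=(H'+\hat F)'\subset H$ is cyclic if and only if $\mathbb C[K^{\perp_{\mathbb R}}\cap H]\cap\mathbb C[H']=\{0\}$. Moreover, $K^{\perp_{\mathbb R}}\cap H=\overline{E_H(i\hat F)}$ and, therefore, $H=K\oplus\overline{E_H(i\hat F)}$. Here the direct sums are orthogonal with respect to $\operatorname{Re}\langle\cdot,\cdot\rangle$.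
   Context: Inner products are linear in the second argument. For a real linear subspace $X\subset\mathcal H$: $\mathbb C[X]=X+iX$; $X'=\{v\in\mathcal H:\operatorname{Im}\langle v,x\rangle=0\ \forall x\in X\}$ (symplectic complement); $X^{\perp_{\mathbb R}}=\{v:\operatorname{Re}\langle v,x\rangle=0\ \forall x\in X\}=iX'$; and $H'^{\perp_{\mathbb R}}$ means $(H')^{\perp_{\mathbb R}}$. $X$ is cyclic if $\mathbb C[X]$ is dense in $\mathcal H$, separating if $X\cap iX=\{0\}$, and a standard subspace if it is closed, cyclic and separating. $E_X$ is the real orthogonal projection (with respect to $\operatorname{Re}\langle\cdot,\cdot\rangle$) onto a closed real linear subspace $X$. *)

(* Defs.v *)
From HB Require Import structures.
From mathcomp Require Import all_boot all_order all_algebra.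
From mathcomp Require Import all_classical all_reals all_analysis.
From mathcomp Require Import complex.

Set Implicit Arguments.
Unset Strict Implicit.
Unset Printing Implicit Defensive.

Import Order.TTheory GRing.Theory Num.Theory.
Import numFieldNormedType.Exports.

Local Open Scope classical_set_scope.
Local Open Scope ring_scope.
Local Open Scope complex_scope.

HB.mixin Record CompleteNormedModule_isHilbert (R : realType) V
    & CompleteNormedModule R[i] V := {
  hilbert_form : {dot V for (@Num.conj R[i])};
  hilbert_formE : forall x : V, hilbert_form x x = `|x| ^+ 2
}.

#[short(type="hilbertType")]
HB.structure Definition Hilbert (R : realType) :=
  {V of CompleteNormedModule R[i] V & CompleteNormedModule_isHilbert R V}.

(* {dot V for _} is linear in its first argument and conjugate-linear in the
   second one, hence the swap: inner is linear in its second argument. *)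
Definition inner (R : realType) (V : hilbertType R) (x y : V) : R[i] :=
  hilbert_form y x.

Definition separable_space (T : topologicalType) :=
  exists2 D : set T, countable D & dense D.

Section RealSubspaces.
Context {R : realType} {V : hilbertType R}.
Implicit Types (X Y Z : set V) (v x y : V).

Definition real_subspace X :=
  X 0 /\ forall (a : R) x y, X x -> X y -> X (a%:C *: x + y).

Definition closed_real_subspace X := real_subspace X /\ closed X.

Definition sum_set X Y : set V := [set x + y | x in X & y in Y].

Definition imul_set X : set V := [set 'i *: x | x in X].

Definition complex_span X : set V := sum_set X (imul_set X).

Definition symplectic_compl X : set V :=
  [set v | forall x, X x -> complex.Im (inner v x) = 0].

Definition real_orth_compl X : set V :=
  [set v | forall x, X x -> complex.Re (inner v x) = 0].

Definition cyclic_set X := dense (complex_span X).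

Definition separating X := X `&` imul_set X = [set 0].

Definition standard_subspace X :=
  [/\ closed_real_subspace X, cyclic_set X & separating X].

(* The unique p in X such that v - p is real orthogonal to X; such a p exists
   as soon as X is a closed real subspace, and 0 is a junk value otherwise. *)
Definition real_proj X v : V :=
  xget 0 [set p | X p /\ real_orth_compl X (v - p)].

(* X is the internal direct sum of Y and Z, with Y and Z orthogonal with
   respect to the real part of the inner product. *)
Definition real_orth_dsum X Y Z :=
  [/\ X = sum_set Y Z, Y `&` Z = [set 0] &
      forall y z, Y y -> Z z -> complex.Re (inner y z) = 0].

End RealSubspaces.

(* Main.v *)
Require Import Defs.
From mathcomp Require Import all_boot all_order all_algebra.
From mathcomp Require Import all_classical all_reals all_analysis.
From mathcomp Require Import complex.
From mathcomp Require Import ring lra.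

Set Implicit Arguments.
Unset Strict Implicit.
Unset Printing Implicit Defensive.

Import Order.TTheory GRing.Theory Num.Theory.
Import numFieldNormedType.Exports.

Local Open Scope classical_set_scope.
Local Open Scope ring_scope.
Local Open Scope complex_scope.

(** Everything takes place in the real Hilbert space obtained from V by keeping
only the real part of the inner product.  Multiplication by i is then a real
orthogonal map with square -1, and the symplectic complement X' of X is the real
orthogonal complement of iX.  Three facts about real subspaces carry the
argument, all resting on the projection theorem ([exists_projection]): X'' is X
when X is closed ([symp_sympK]); the complement of a subspace of a closed X
taken twice inside X is its closure ([relative_biorth]); and a real subspace is
cyclic exactly when its symplectic complement is separating ([cyclic_symp]),
because X' meets iX' in the complex orthogonal complement of X.  In particular
symplectic complements of standard subspaces are standard.

For (b), write S for the added subspace.  Then K = (H' + S)' is the intersection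
of H'' = H and S', that is, the part of H real orthogonal to iS.  The real inner
product of a vector of H with v is its inner product with E_H(v), so K is also the complement inside H of E_H(iS), and taking
complements inside H once more gives M = N and the decomposition of H.  For the
cyclicity criterion ([cyclic_subspaceP]), the real complement of K splits as
M + iH'.  Hence a vector w such that w and iw both lie in it gives two relations
w = m1 + i h1 and iw = m2 + i h2, which combine into an equality between an
element of C[M] and an element of C[H']; conversely a common element of these
two spans gives back such a w.  If the common element vanishes, so does w, because
M lies in the separating space H and H' is separating; if w vanishes, so does the
common element, because M and iH' are real orthogonal.

Part (a) is (b) for the standard subspace K': its symplectic complement is
K'' = K, and (K + F)' = H' because complements do not see closures; finally H is
separating exactly when H' is cyclic. *)

Section RealForm.
Context {R : realType} {V : hilbertType R}.
Implicit Types (a : R) (x y z u v : V) (X Y Z : set V).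

(** * The underlying real inner product space *)

Definition rdot x y : R := complex.Re (inner x y).

Lemma Re_innerE x y : complex.Re (inner x y) = rdot x y. Proof. by []. Qed.

(** The norm of V takes its values in R[i]; this is its version with values
in R, on which one can use the order. *)
Definition hnorm x : R := Num.sqrt (rdot x x).

Lemma innerC x y : inner y x = (inner x y)^*.
Proof. by rewrite /inner (hermC _ x y) expr0 mul1r. Qed.

Lemma innerDr x y z : inner x (y + z) = inner x y + inner x z.
Proof. by rewrite /inner linearDl. Qed.

Lemma innerZr x (c : R[i]) y : inner x (c *: y) = c * inner x y.
Proof. by rewrite /inner linearZl_LR. Qed.

Lemma rdotC x y : rdot x y = rdot y x.
Proof. by rewrite /rdot (innerC x y); case: (inner x y). Qed.

Lemma rdotDr x y z : rdot x (y + z) = rdot x y + rdot x z.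
Proof. by rewrite /rdot innerDr; case: (inner x y); case: (inner x z). Qed.

Lemma rdotZr x a y : rdot x (a%:C *: y) = a * rdot x y.
Proof.
rewrite /rdot innerZr; case: (inner x y) => p q /=.
by rewrite mul0r subr0.
Qed.

(** The symplectic form is the real form twisted by i, so that everything about
symplectic complements reduces to real orthogonality. *)
Lemma Im_inner x y : complex.Im (inner x y) = rdot ('i *: x) y.
Proof.
rewrite rdotC /rdot innerZr (innerC x y) -complexiE; case: (inner x y) => p q.
by rewrite /=; ring.
Qed.

Lemma rdotii x y : rdot ('i *: x) ('i *: y) = rdot x y.
Proof.
by rewrite -Im_inner innerZr -complexiE /rdot; case: (inner x y) => p q /=; ring.
Qed.

Lemma rdotDl x y z : rdot (x + y) z = rdot x z + rdot y z.
Proof. by rewrite rdotC rdotDr !(rdotC z). Qed.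

Lemma rdotZl a x z : rdot (a%:C *: x) z = a * rdot x z.
Proof. by rewrite rdotC rdotZr (rdotC z). Qed.

Lemma rdotNr x y : rdot x (- y) = - rdot x y.
Proof. by rewrite -mulN1r -rdotZr rmorphN1 scaleN1r. Qed.

Lemma rdotNl x y : rdot (- x) y = - rdot x y.
Proof. by rewrite rdotC rdotNr rdotC. Qed.

Lemma rdot0r x : rdot x 0 = 0.
Proof. by rewrite -(scale0r 0) (rdotZr x 0 0) mul0r. Qed.

Lemma rdot0l x : rdot 0 x = 0.
Proof. by rewrite rdotC rdot0r. Qed.

Definition rdotE := (rdotDl, rdotDr, rdotZl, rdotZr, rdotNl, rdotNr).

Lemma rdotxxE x : (rdot x x)%:C = `|x| ^+ 2.
Proof.
by rewrite -hilbert_formE /rdot /inner RRe_real // hilbert_formE realX // normr_real.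
Qed.

Lemma rdot_ge0 x : 0 <= rdot x x.
Proof. by rewrite -ler0c rdotxxE exprn_ge0. Qed.

Lemma rdot_eq0 x : rdot x x = 0 -> x = 0.
Proof.
move=> x0; apply/normr0_eq0/eqP.
have : `|x| ^+ 2 == 0 :> R[i] by rewrite -rdotxxE x0.
by rewrite expf_eq0.
Qed.

Lemma sqr_hnorm x : hnorm x ^+ 2 = rdot x x.
Proof. by rewrite sqr_sqrtr // rdot_ge0. Qed.

Lemma hnorm_ge0 x : 0 <= hnorm x.
Proof. exact: sqrtr_ge0. Qed.

Lemma hnormE x : `|x| = (hnorm x)%:C.
Proof.
apply/eqP; rewrite -(@eqrXn2 _ 2) ?ler0c ?hnorm_ge0 //.
by rewrite -rmorphXn sqr_hnorm -rdotxxE.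
Qed.

Lemma hnormD x y : hnorm (x + y) <= hnorm x + hnorm y.
Proof. by have := ler_normD x y; rewrite !hnormE -rmorphD lecR. Qed.

Lemma hnormN x : hnorm (- x) = hnorm x.
Proof. by rewrite /hnorm !rdotE opprK. Qed.

(** Positivity of the form at [(y.y) x - (x.y) y], divided by [y.y]. *)
Lemma cauchy_schwarz x y : `|rdot x y| <= hnorm x * hnorm y.
Proof.
have [/rdot_eq0 ->|y0] := eqVneq (rdot y y) 0.
  by rewrite rdot0r normr0 mulr_ge0 ?hnorm_ge0.
have yp : 0 < rdot y y by rewrite lt_def y0 rdot_ge0.
rewrite -(@ler_pXn2r _ 2) ?nnegrE ?mulr_ge0 ?hnorm_ge0 //.
rewrite exprMn !sqr_hnorm real_normK ?num_real //.
rewrite -(ler_pM2l yp) -subr_ge0.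
set t := - rdot x y; set s := rdot y y.
have := rdot_ge0 (s%:C *: x + t%:C *: y).
rewrite !rdotE (rdotC y x) -/s /t; congr (_ <= _); ring.
Qed.

(** The balls of V have complex radii; real ones suffice because a positive
complex number is real. *)
Lemma closureP X x :
  closure X x <-> forall e : R, 0 < e -> exists2 y, X y & hnorm (x - y) < e.
Proof.
split=> [Xx e e0|Xx B].
  have : nbhs x (ball x (e%:C)) by apply: nbhsx_ballx; rewrite ltcR.
  move=> /Xx[y [Xy]]; rewrite -ball_normE /= hnormE ltcR => xy.
  by exists y.
move=> /nbhs_ballP[e /= e0 eB].
have eE : e = (complex.Re e)%:C by rewrite RRe_real // gtr0_real.
move: e0; rewrite eE ltcR => /Xx[y Xy xy].
exists y; split=> //; apply: eB.
by rewrite -ball_normE /= hnormE eE ltcR.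
Qed.

Lemma dense_closure X : dense X <-> forall x, closure X x.
Proof.
split=> [dX x B | cX U [x Ux] oU].
  rewrite nbhsE => -[U [oU Ux] UB].
  by have [y [Uy Xy]] := dX U (ex_intro _ x Ux) oU; exists y; split=> //; exact: UB.
have [|y [Xy Uy]] := cX x U; first exact: open_nbhs_nbhs.
by exists y.
Qed.

(** * Real subspaces and real orthogonal complements *)

Local Notation orth := real_orth_compl.

Lemma subspaceB X x y : real_subspace X -> X x -> X y -> X (x - y).
Proof.
move=> [_ XP] Xx Xy; have := XP (-1) y x Xy Xx.
by rewrite rmorphN1 scaleN1r addrC.
Qed.

Lemma subspaceD X x y : real_subspace X -> X x -> X y -> X (x + y).
Proof.
by move=> [_ XP] Xx Xy; have := XP 1 x y Xx Xy; rewrite rmorph1 scale1r.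
Qed.

Lemma subspaceZ X a x : real_subspace X -> X x -> X (a%:C *: x).
Proof.
by move=> [X0 XP] Xx; have := XP a x 0 Xx X0; rewrite addr0.
Qed.

Lemma subspaceN X x : real_subspace X -> X x -> X (- x).
Proof. by move=> sX Xx; have := subspaceB sX (proj1 sX) Xx; rewrite sub0r. Qed.

(** Closedness comes from Cauchy-Schwarz: if x is at distance less than d from
the complement, then [x.z] is at most d times the norm of z. *)
Lemma orth_closed X : closed_real_subspace (orth X).
Proof.
split; first split.
- by move=> x Xx; exact: rdot0l.
- move=> a x y Xx Xy z Xz; rewrite -/(rdot _ _) rdotDl rdotZl.
  by rewrite /rdot Xx // Xy // mulr0 addr0.
- move=> x /closureP cx z Xz; apply/eqP; rewrite -normr_le0 -/(rdot _ _).
  rewrite leNgt; apply/negP => h.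
  (* adding 1 keeps the denominator positive when z = 0 *)
  have [|y Xy xy] := cx (`|rdot x z| / (hnorm z + 1)).
    by rewrite divr_gt0 // ltr_wpDl ?hnorm_ge0.
  have : `|rdot x z| <= hnorm (x - y) * hnorm z.
    apply: le_trans (cauchy_schwarz _ _).
    by rewrite rdotDl rdotNl [rdot y z]Xy // subr0.
  have hz := hnorm_ge0 z.
  move: xy; rewrite ltr_pdivlMr ?ltr_wpDl //.
  have := hnorm_ge0 (x - y); nra.
Qed.

Lemma orth_sub X Y : X `<=` Y -> orth Y `<=` orth X.
Proof. by move=> XY x Yx z /XY; exact: Yx. Qed.

Lemma sub_orth_orth X : X `<=` orth (orth X).
Proof. by move=> x Xx z Xz; rewrite -/(rdot _ _) rdotC; exact: Xz. Qed.

(** X is contained in its double complement, which is closed, so the closure of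
X is contained in it too. *)
Lemma orth_closure X : orth (closure X) = orth X.
Proof.
rewrite eqEsubset; split; first exact/orth_sub/subset_closure.
move=> x Xx z cz.
have [_ cX] := orth_closed (orth X).
rewrite -/(rdot _ _) rdotC; apply: (cX z _ x Xx).
exact: (closure_subset (@sub_orth_orth X)).
Qed.

Lemma orth_self X x : X x -> orth X x -> x = 0.
Proof. by move=> Xx oX; apply: rdot_eq0; exact: oX. Qed.

Lemma closure_subspace X : real_subspace X -> closed_real_subspace (closure X).
Proof.
move=> sX; split; last exact: closed_closure.
split; first by apply: subset_closure; case: sX.
move=> a x y /closureP cx /closureP cy; apply/closureP => e e0.
have a0 : 0 < `|a| + 1 by rewrite ltr_wpDl.
have [|x' Xx' xx'] := cx (e / 2 / (`|a| + 1)); first by rewrite !divr_gt0.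
have [|y' Xy' yy'] := cy (e / 2); first by rewrite divr_gt0.
exists (a%:C *: x' + y'); first by case: sX => _; apply.
have -> : a%:C *: x + y - (a%:C *: x' + y') = a%:C *: (x - x') + (y - y').
  by rewrite scalerBr opprD addrACA.
apply: le_lt_trans (hnormD _ _) _.
have -> : hnorm (a%:C *: (x - x')) = `|a| * hnorm (x - x').
  by rewrite /hnorm rdotZl rdotZr mulrA -expr2 sqrtrM ?sqr_ge0 // sqrtr_sqr.
move: xx'; rewrite ltr_pdivlMr //; have := hnorm_ge0 (x - x'); lra.
Qed.

(** * The projection theorem *)

Lemma parallelogram x y :
  rdot (x - y) (x - y) + rdot (x + y) (x + y) = 2 * rdot x x + 2 * rdot y y.
Proof. rewrite !rdotE (rdotC y x); ring. Qed.

(** Completeness of V, with an explicit modulus b so that only real epsilons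
occur. *)
Lemma hnorm_cauchy_cvg (u : nat -> V) (b : nat -> R) :
  (forall e, 0 < e -> exists n, b n < e) ->
  (forall n m k, (n <= m)%N -> (n <= k)%N -> hnorm (u m - u k) <= b n) ->
  exists p, forall e, 0 < e -> exists N, forall n, (N <= n)%N -> hnorm (p - u n) < e.
Proof.
move=> b0 ub.
have cu : cauchy (u @ \oo).
  apply: cauchy_exP => e e0.
  have eE : e = (complex.Re e)%:C by rewrite RRe_real // gtr0_real.
  move: e0; rewrite eE ltcR => e0.
  have [n bn] := b0 _ e0.
  exists (u n); exists n => // m /= nm.
  rewrite -ball_normE /= hnormE ltcR.
  by apply: le_lt_trans bn; exact: ub.
have [p up] : exists p : V, u @ \oo --> p by exists (lim (u @ \oo)); exact: cauchy_cvg.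
exists p => e e0.
have : nbhs p (ball p (e%:C)) by apply: nbhsx_ballx; rewrite ltcR.
move=> /up[N _ NB]; exists N => n Nn.
by have := NB n Nn; rewrite -ball_normE /= hnormE ltcR.
Qed.

Section Projection.
Variables (X : set V) (v : V).
Hypotheses (sX : real_subspace X) (cX : closed X).

Let dist : R := inf [set hnorm (v - x) | x in X].

Let dist_le x : X x -> dist <= hnorm (v - x).
Proof.
move=> Xx; apply: ge_inf; last by exists x.
by exists 0 => _ [y _ <-]; exact: hnorm_ge0.
Qed.

Let dist_ge0 : 0 <= dist.
Proof.
apply: lb_le_inf; first by exists (hnorm (v - 0)); exists 0 => //; case: sX.
by move=> _ [y _ <-]; exact: hnorm_ge0.
Qed.

Let dist_approx e : 0 < e -> exists2 x, X x & hnorm (v - x) < dist + e.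
Proof.
move=> e0.
have hi : has_inf [set hnorm (v - x) | x in X].
  split; first by exists (hnorm (v - 0)); exists 0 => //; case: sX.
  by exists 0 => _ [y _ <-]; exact: hnorm_ge0.
by have [_ [x Xx <-] h] := inf_adherent e0 hi; exists x.
Qed.

(** A minimizing sequence is Cauchy: by the parallelogram law the distance of two
of its terms is controlled by how far v is from them and from their midpoint,
and the midpoint, being in X, is at least [dist] away. *)
Lemma exists_nearest : exists2 p, X p & forall x, X x -> hnorm (v - p) <= hnorm (v - x).
Proof.
have /choice[u uP] : forall n : nat, exists x, X x /\ hnorm (v - x) < dist + n.+1%:R^-1.
  move=> n; have [|x Xx xd] := @dist_approx n.+1%:R^-1; first by rewrite invr_gt0.
  by exists x.
(* with e = 1/(n+1) the parallelogram law bounds the squared distance by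
   4 ((dist + e)^2 - dist^2) = 8 dist e + 4 e^2, and e^2 <= e *)
pose b (n : nat) := Num.sqrt ((8 * dist + 4) * n.+1%:R^-1).
have c0 : 0 < 8 * dist + 4 by have := dist_ge0; lra.
have inv_small e : 0 < e -> exists n : nat, n.+1%:R^-1 < e :> R.
  move=> e0; have [n hn] : exists n : nat, e^-1 < n.+1%:R.
    by exists (Num.truncn e^-1); exact: truncnS_gt.
  by exists n; rewrite invf_plt ?posrE.
have [|n m k nm nk|p pP] := @hnorm_cauchy_cvg u b.
- move=> e e0; have [|n hn] := inv_small (e ^+ 2 / (8 * dist + 4)).
    by rewrite divr_gt0 // exprn_gt0.
  exists n; rewrite -(@ltr_pXn2r _ 2) ?nnegrE ?sqrtr_ge0 ?(ltW e0) //.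
  rewrite sqr_sqrtr; first by rewrite mulrC -ltr_pdivlMr.
  by rewrite mulr_ge0 ?invr_ge0 // ltW.
- have [Xm um] := uP m; have [Xk uk] := uP k.
  rewrite /b /hnorm ler_wsqrtr //.
  have := parallelogram (v - u m) (v - u k).
  have -> : v - u m - (v - u k) = - (u m - u k).
    by rewrite opprB addrC addrA subrK opprB.
  have -> : v - u m + (v - u k) = 2%:C *: (v - (2^-1)%:C *: (u m + u k)).
    rewrite scalerBr scalerA -rmorphM divff ?pnatr_eq0 // rmorph1 scale1r.
    by rewrite rmorph_nat scaler_nat mulr2n opprD addrACA.
  have := dist_le (subspaceZ 2^-1 sX (subspaceD sX Xm Xk)).
  set w := v - _ *: _.
  rewrite rdotZl rdotZr rdotNl rdotNr opprK -!sqr_hnorm.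
  have em : m.+1%:R^-1 <= n.+1%:R^-1 :> R by rewrite lef_pV2 ?posrE // ler_nat.
  have ek : k.+1%:R^-1 <= n.+1%:R^-1 :> R by rewrite lef_pV2 ?posrE // ler_nat.
  have e1 : n.+1%:R^-1 <= 1 :> R by rewrite invf_le1 // ler1n.
  have e0 : 0 < n.+1%:R^-1 :> R by rewrite invr_gt0.
  move: (hnorm_ge0 (v - u m)) (hnorm_ge0 (v - u k)) um uk em ek e1 e0 dist_ge0.
  move: (hnorm (v - u m)) (hnorm (v - u k)) (hnorm w) => s t r.
  set e := n.+1%:R^-1 => s0 t0 sd td me ke e1 e0 d0 dr H.
  have sde : s <= dist + e by apply/ltW/(lt_le_trans sd); rewrite lerD2l.
  have tde : t <= dist + e by apply/ltW/(lt_le_trans td); rewrite lerD2l.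
  have de : 0 <= dist + e by lra.
  have s2 : s ^+ 2 <= (dist + e) ^+ 2 by rewrite ler_pXn2r ?nnegrE.
  have t2 : t ^+ 2 <= (dist + e) ^+ 2 by rewrite ler_pXn2r ?nnegrE.
  have r0 : 0 <= r by lra.
  have r2 : dist ^+ 2 <= r ^+ 2 by rewrite ler_pXn2r ?nnegrE.
  have ee : e * e <= e by nra.
  lra.
- have Xp : X p.
    apply: cX; apply/closureP => e /pP[N NP].
    by exists (u N); [case: (uP N)|exact: NP].
  exists p => // x Xx; apply: le_trans (dist_le Xx).
  apply/ler_addgt0Pr => e e0.
  have e2 : 0 < e / 2 by rewrite divr_gt0.
  have [N NP] := pP _ e2; have [M hM] := inv_small _ e2.
  pose n := maxn N M.
  have nM : n.+1%:R^-1 <= M.+1%:R^-1 :> R.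
    by rewrite lef_pV2 ?posrE // ler_nat ltnS leq_maxr.
  have [_ un] := uP n.
  have {}un : hnorm (v - u n) < dist + e / 2.
    by apply: lt_trans un _; rewrite ltrD2l (le_lt_trans nM).
  have := NP n (leq_maxl _ _).
  have := hnormD (v - u n) (- (p - u n)).
  rewrite hnormN opprB addrA subrK; lra.
Qed.

(** First variation: if r = [(v - p).y] were nonzero, moving p by a small multiple
of y would bring it closer to v. *)
Lemma exists_projection : exists2 p, X p & orth X (v - p).
Proof.
have [p Xp pmin] := exists_nearest; exists p => // y Xy.
rewrite -/(rdot _ _); set r := rdot _ _; set q := rdot y y.
have q0 : 0 <= q := rdot_ge0 y.
(* r / q would be the optimal step; r / (q + 1) also works when y = 0 *)
have {pmin} := pmin _ (subspaceD sX Xp (subspaceZ (r / (q + 1)) sX Xy)).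
rewrite opprD addrA -(@ler_pXn2r _ 2) ?nnegrE ?hnorm_ge0 // !sqr_hnorm.
rewrite !rdotE (rdotC y p) (rdotC y v).
have -> : rdot v y = r + rdot p y by rewrite /r rdotDl rdotNl subrK.
rewrite -/q => H; apply/eqP; rewrite -sqrf_eq0; apply/eqP.
have {H} : 0 <= - (r ^+ 2 * (q + 2)) / (q + 1) ^+ 2.
  rewrite -subr_ge0 in H; apply: le_trans H _; rewrite le_eqVlt; apply/orP; left.
  by apply/eqP; field; apply/eqP; lra.
rewrite pmulr_lge0 ?invr_gt0 ?exprn_gt0 ?ltr_wpDl //.
have := sqr_ge0 r; nra.
Qed.
End Projection.

Lemma orth_orth X : closed_real_subspace X -> orth (orth X) = X.
Proof.
move=> [sX cX]; rewrite eqEsubset; split; last exact: sub_orth_orth.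
move=> v vX; have [p Xp pX] := exists_projection v sX cX.
have [soo _] := orth_closed (orth X).
suff /eqP : v - p = 0 by rewrite subr_eq0 => /eqP ->.
apply: (orth_self pX); apply: (subspaceB soo) => //; exact: sub_orth_orth.
Qed.

Lemma real_projP X v : closed_real_subspace X ->
  X (real_proj X v) /\ orth X (v - real_proj X v).
Proof.
move=> [sX cX]; have [p Xp pX] := exists_projection v sX cX.
rewrite /real_proj; case: xgetP => [y _ //|].
by move=> /(_ p) [].
Qed.

Lemma real_proj_unique X v p : closed_real_subspace X ->
  X p -> orth X (v - p) -> real_proj X v = p.
Proof.
move=> cX Xp pX; have [Xq qX] := real_projP v cX.
apply/eqP; rewrite -subr_eq0; apply/eqP; apply: (@orth_self X).
  by apply: subspaceB => //; case: cX.
have [so _] := orth_closed X.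
have -> : real_proj X v - p = (v - p) - (v - real_proj X v).
  by rewrite opprB [RHS]addrC addrA subrK.
exact: (subspaceB so).
Qed.

(** * Symplectic complements *)

Local Notation symp := symplectic_compl.

Lemma scaleii x : 'i *: ('i *: x) = - x.
Proof. by rewrite scalerA -expr2 sqrCi scaleN1r. Qed.

Lemma sympE X v : symp X v <-> orth X ('i *: v).
Proof.
by split=> h x Xx; have := h x Xx; rewrite Im_inner.
Qed.

Lemma rdot_scaleil x y : rdot ('i *: x) y = - rdot x ('i *: y).
Proof. by rewrite -rdotii scaleii rdotNl. Qed.

Lemma orthE X v : orth X v <-> symp X ('i *: v).
Proof.
have [so _] := orth_closed X.
rewrite sympE scaleii; split=> h; first exact: (subspaceN so).
by rewrite -[v]opprK; exact: (subspaceN so).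
Qed.

Lemma sympi X v : symp X v <-> orth (imul_set X) v.
Proof.
split=> [h _ [x Xx <-]|h x Xx].
  by rewrite Re_innerE -[LHS]opprK -rdot_scaleil -Im_inner h // oppr0.
by rewrite Im_inner rdot_scaleil -Re_innerE h ?oppr0 //; exists x.
Qed.

Lemma symp_imulE X : symp X = orth (imul_set X).
Proof. by apply/seteqP; split=> v /sympi. Qed.

Lemma symp_closed X : closed_real_subspace (symp X).
Proof. by rewrite symp_imulE; exact: orth_closed. Qed.

(** Multiplication by i is orthogonal, so the two factors i relating the
symplectic complement to the orthogonal one cancel in the double complement. *)
Lemma symp_symp X : symp (symp X) = orth (orth X).
Proof.
rewrite eqEsubset; split=> v h w wX.
  rewrite Re_innerE -[LHS]opprK -rdotNr -scaleii -rdot_scaleil -Im_inner h ?oppr0 //.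
  exact/orthE.
by rewrite Im_inner rdot_scaleil -Re_innerE h ?oppr0 //; exact/sympE.
Qed.

Lemma symp_sympK X : closed_real_subspace X -> symp (symp X) = X.
Proof. by rewrite symp_symp; exact: orth_orth. Qed.

Lemma symp_sub X Y : X `<=` Y -> symp Y `<=` symp X.
Proof. by move=> XY x Yx z /XY; exact: Yx. Qed.

Lemma symp_closure X : symp (closure X) = symp X.
Proof.
rewrite eqEsubset; split; first exact/symp_sub/subset_closure.
by move=> v /sympE; rewrite -orth_closure => /sympE.
Qed.

Lemma symp_sum X Y : X 0 -> Y 0 -> symp (sum_set X Y) = symp X `&` symp Y.
Proof.
move=> X0 Y0; rewrite eqEsubset; split=> v.
  move=> h; split=> x Xx; apply: h; first by exists x => //; exists 0; rewrite ?addr0.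
  by exists 0 => //; exists x; rewrite ?add0r.
move=> [hX hY] _ [x Xx [y Yy <-]].
by rewrite Im_inner rdotDr -!Im_inner hX // hY // addr0.
Qed.

Lemma sum_subspace X Y : real_subspace X -> real_subspace Y ->
  real_subspace (sum_set X Y).
Proof.
move=> [X0 XP] [Y0 YP]; split; first by exists 0 => //; exists 0; rewrite ?addr0.
move=> a _ _ [x Xx [y Yy <-]] [x' Xx' [y' Yy' <-]].
exists (a%:C *: x + x'); first exact: XP.
by exists (a%:C *: y + y'); [exact: YP|rewrite scalerDr addrACA].
Qed.

Lemma imul_subspace X : real_subspace X -> real_subspace (imul_set X).
Proof.
move=> [X0 XP]; split; first by exists 0; rewrite ?scaler0.
move=> a _ _ [x Xx <-] [y Xy <-]; exists (a%:C *: x + y); first exact: XP.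
by rewrite scalerDr !scalerA mulrC.
Qed.

Lemma span_subspace X : real_subspace X -> real_subspace (complex_span X).
Proof. by move=> sX; apply: sum_subspace => //; exact: imul_subspace. Qed.

(** Real orthogonality to the complex span is complex orthogonality to X. *)
Lemma orth_span X v : real_subspace X ->
  orth (complex_span X) v <-> orth X v /\ symp X v.
Proof.
move=> [X0 _]; split=> [h|[h1 h2]].
  split=> [x Xx|].
    by apply: h; exists x => //; exists 0; rewrite ?addr0 //; exists 0; rewrite ?scaler0.
  apply/sympi => _ [x Xx <-]; apply: h.
  by exists 0 => //; exists ('i *: x); rewrite ?add0r //; exists x.
move=> _ [x Xx [_ [y Xy <-] <-]]; rewrite Re_innerE rdotDr -!Re_innerE h1 // add0r.
by move/sympi: h2; apply; exists y.
Qed.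

(** For the reverse implication, the closure of X is its own double complement,
and the complement of {0} is everything. *)
Lemma dense_orth X : real_subspace X -> dense X <-> orth X `<=` [set 0].
Proof.
move=> sX; rewrite dense_closure -orth_closure; split=> [cX v vX|h v].
  exact: (orth_self (cX v)).
have cX := closure_subspace sX.
rewrite -(orth_orth cX) => w /h ->.
by rewrite Re_innerE rdot0r.
Qed.

Lemma separatingP X : real_subspace X ->
  separating X <-> forall v, X v -> X ('i *: v) -> v = 0.
Proof.
move=> sX; split=> [h v Xv Xiv|h].
  suff : [set 0] ('i *: v).
    by move/(congr1 (fun w => - ('i *: w))); rewrite scaleii opprK scaler0 oppr0.
  by rewrite -h; split => //; exists v.
rewrite /separating eqEsubset; split=> [v [Xv [w Xw wv]]|_ ->].
  by rewrite -wv (h w) ?scaler0 // wv.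
by case: (sX) => X0 _; split=> //; exists 0; rewrite ?scaler0.
Qed.

(** Both sides say that no nonzero vector is complex orthogonal to X. *)
Lemma cyclic_symp X : real_subspace X -> cyclic_set X <-> separating (symp X).
Proof.
move=> sX; have [ss _] := symp_closed X.
rewrite (separatingP ss) /cyclic_set (dense_orth (span_subspace sX)); split.
  move=> h v Xv Xiv; apply: h; apply/(orth_span _ sX); split=> //.
  exact/orthE.
by move=> h v /(orth_span _ sX)[/orthE Xiv Xv]; exact: h.
Qed.

(** Cyclicity and separation are exchanged by [symp], an involution on closed
real subspaces. *)
Lemma symp_standard X : standard_subspace X -> standard_subspace (symp X).
Proof.
move=> [cX yX sX]; have [rX _] := cX; have cs := symp_closed X; have [rs _] := cs.
split=> //; last exact/cyclic_symp.
by apply/(cyclic_symp rs); rewrite symp_sympK.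
Qed.

(** * Complements inside a closed real subspace *)

Lemma real_proj_image X (S : set V) : closed_real_subspace X -> real_subspace S ->
  real_subspace (real_proj X @` S).
Proof.
move=> cX [S0 SP]; have [rX _] := cX; have [ro _] := orth_closed X.
split.
  exists 0 => //; apply: real_proj_unique => //; rewrite ?subr0.
  - by case: rX.
  - by case: ro.
move=> a _ _ [x Sx <-] [y Sy <-]; exists (a%:C *: x + y); first exact: SP.
have [Xx ox] := real_projP x cX; have [Xy oy] := real_projP y cX.
apply: real_proj_unique => //; first by case: rX => _; apply.
rewrite opprD addrACA -scalerBr.
by case: ro => _; apply.
Qed.

(** A vector of X has the same real inner product with s as with the projection
of s onto X. *)
Lemma orth_real_proj X (S : set V) : closed_real_subspace X ->
  X `&` orth (real_proj X @` S) = X `&` orth S.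
Proof.
move=> cX.
have E x s : X x -> rdot x s = rdot x (real_proj X s).
  have [_ os] := real_projP s cX => Xx.
  rewrite -[in LHS](subrK (real_proj X s) s) rdotDr rdotC -Re_innerE os //.
  by rewrite add0r.
rewrite eqEsubset; split=> x [Xx h]; split=> // s.
  by move=> Ss; rewrite Re_innerE E // -Re_innerE h //; exists s.
by move=> [t St <-]; rewrite Re_innerE -E // -Re_innerE h.
Qed.

(** The bipolar theorem inside X.  Projecting v onto the closure of S leaves a
remainder that lies in X and is orthogonal to S; it is also orthogonal to all
such vectors, hence to itself. *)
Lemma relative_biorth X (S : set V) :
  closed_real_subspace X -> real_subspace S -> S `<=` X ->
  orth (X `&` orth S) `&` X = closure S.
Proof.
move=> [rX cX] rS SX; have cS := closure_subspace rS.
have SX' : closure S `<=` X by move=> x /(closure_subset SX) /cX.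
rewrite eqEsubset; split=> v.
  move=> [ov Xv]; have [Sp op] := real_projP v cS.
  set p := real_proj _ v in Sp op.
  have K : (X `&` orth S) (v - p).
    split; last by rewrite -orth_closure.
    by apply: subspaceB => //; exact: SX'.
  suff /eqP : v - p = 0 by rewrite subr_eq0 => /eqP ->.
  apply: (orth_self K); have [ro _] := orth_closed (X `&` orth S).
  apply: (subspaceB ro) => // w [_ ow].
  by rewrite Re_innerE rdotC -Re_innerE; move: ow; rewrite -orth_closure; exact.
move=> cv; split; last exact: SX'.
move=> w [_ ow].
by rewrite Re_innerE rdotC -Re_innerE; move: ow; rewrite -orth_closure; exact.
Qed.

Lemma orth_decomp X Y : closed_real_subspace X -> real_subspace Y -> X `<=` Y ->
  real_orth_dsum Y X (orth X `&` Y).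
Proof.
move=> cX rY XY; split.
- rewrite eqEsubset; split=> [v Yv|_ [x Xx [y [_ Yy] <-]]].
    have [Xp op] := real_projP v cX.
    exists (real_proj X v) => //; exists (v - real_proj X v).
      by split=> //; apply: subspaceB => //; exact: XY.
    by rewrite addrC subrK.
  by apply: subspaceD => //; exact: XY.
- rewrite eqEsubset; split=> [x [Xx [ox _]]|_ ->]; first exact: (orth_self Xx).
  have [[X0 _] _] := cX; split=> //; split; last exact: XY.
  by case: (orth_closed X) => -[].
- by move=> x z Xx [oz _]; rewrite Re_innerE rdotC -Re_innerE oz.
Qed.

(** * The cyclicity criterion and the proposition *)

(** The complement of K is M + iH', where M is its part inside H; [decK] below.
K is cyclic exactly when no nonzero w has both w and iw in that complement. *)
Lemma cyclic_subspaceP (H K : set V) :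
  standard_subspace H -> closed_real_subspace K ->
  K `<=` H ->
  cyclic_set K <->
  complex_span (orth K `&` H) `&` complex_span (symp H) = [set 0].
Proof.
move=> sH cK KH; have [cH _ _] := sH; have [rH _] := cH; have [rK _] := cK.
have [[rs cs] _ sepsH] := symp_standard sH.
have [ro _] := orth_closed K; have [rsK _] := symp_closed K.
have {}sepsH := proj1 (separatingP rs) sepsH.
have sepH : forall v, H v -> H ('i *: v) -> v = 0.
  by case: sH => _ _ /(separatingP rH).
have rM : real_subspace (orth K `&` H).
  split; first by split; [case: ro|case: rH].
  by move=> a x y [ox Hx] [oy Hy]; split; [case: ro|case: rH] => _; apply.
have decK v : orth K v ->
    exists2 m, (orth K `&` H) m & exists2 h, symp H h & v = m + 'i *: h.
  move=> ov; have [Hp op] := real_projP v cH.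
  have op' := orth_sub KH op.
  exists (real_proj H v).
    split=> //; rewrite -[real_proj H v](subKr v); exact: (subspaceB ro).
  exists (- ('i *: (v - real_proj H v))); first by apply: (subspaceN rs); exact/orthE.
  by rewrite scalerN scaleii opprK addrC subrK.
have isH h : symp H h -> orth H ('i *: h) by move=> /sympE.
rewrite (cyclic_symp rK) (separatingP rsK); split=> [sep|tr v /sympE Kiv].
  rewrite eqEsubset; split; last first.
    move=> _ ->; split; first by case: (span_subspace rM).
    by case: (span_subspace rs).
  move=> z [[m1 [om1 Hm1] [_ [m2 [om2 Hm2] <-] zm]] [h2 sh2 [_ [h1 sh1 <-] zh]]].
  have key : m1 - 'i *: h1 = h2 - 'i *: m2.
    by apply/eqP; rewrite subr_eq addrAC eq_sym subr_eq zh zm.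
  have oih1 := orth_sub KH (isH _ sh1); have oih2 := orth_sub KH (isH _ sh2).
  (* w = m1 - i h1 and i w = m2 + i h2 are both orthogonal to K *)
  have w1 : orth K (m1 - 'i *: h1) by exact: (subspaceB ro).
  have w2 : orth K ('i *: (m1 - 'i *: h1)).
    rewrite key scalerBr scaleii opprK; exact: (subspaceD ro).
  have w0 : m1 - 'i *: h1 = 0.
    by apply: sep; [apply/sympE|apply/orthE; rewrite ?scaleii].
  have m10 : m1 = 0.
    apply: (orth_self Hm1); rewrite -[m1](subrK ('i *: h1)) w0 add0r; exact: isH.
  have w0' : m2 + 'i *: h2 = 0.
    have : 'i *: (h2 - 'i *: m2) = 0 by rewrite -key w0 scaler0.
    by rewrite scalerBr scaleii opprK addrC.
  have m20 : m2 = 0.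
    apply: (orth_self Hm2); have [roH _] := orth_closed H.
    have -> : m2 = - ('i *: h2) by apply/eqP; rewrite -addr_eq0 w0'.
    apply: (subspaceN roH); exact: isH.
  by rewrite /= -zm m10 m20 scaler0 addr0.
move=> /sympE; rewrite scaleii => Kv.
have {}Kv : orth K v by rewrite -[v]opprK; exact: (subspaceN ro).
have [m1 Mm1 [h1 sh1 E1]] := decK _ Kv.
have [m2 Mm2 [h2 sh2 E2]] := decK _ Kiv.
(* multiply i v = m2 + i h2 by i and add it to v = m1 + i h1 *)
have key : m1 + 'i *: m2 = h2 - 'i *: h1.
  have : 'i *: ('i *: v) = 'i *: m2 - h2 by rewrite E2 scalerDr scaleii.
  rewrite scaleii E1 => /(congr1 (fun w => m1 + h2 + w)).
  move=> K1; have {K1} := esym K1.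
  by rewrite addrACA subrr addr0 opprD addrACA subrr add0r.
have z0 : m1 + 'i *: m2 = 0.
  suff : [set 0] (m1 + 'i *: m2) by [].
  rewrite -tr; split.
    by exists m1 => //; exists ('i *: m2) => //; exists m2.
  rewrite key; exists h2 => //; exists ('i *: - h1); last by rewrite scalerN.
  by exists (- h1) => //; exact: (subspaceN rs).
have Em1 : m1 = - ('i *: m2) by apply/eqP; rewrite -addr_eq0 z0.
have m20 : m2 = 0.
  apply: sepH; first by case: Mm2.
  rewrite -[_ *: _]opprK -Em1; apply: subspaceN => //; by case: Mm1.
have h10 : h1 = 0.
  apply: sepsH => //.
  suff -> : 'i *: h1 = h2 by [].
  by apply/eqP; rewrite eq_sym -subr_eq0 -key z0.
by rewrite E1 Em1 m20 h10 !scaler0 oppr0 addr0.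
Qed.

(** The projection of iS onto H enters because K is the complement of iS inside H,
and [relative_biorth] asks for a subspace that is contained in H. *)
Lemma relative_symp_compl (H S : set V) : standard_subspace H -> closed_real_subspace S ->
     let K := symplectic_compl (sum_set (symplectic_compl H) S) in
     let M := real_orth_compl K `&` H in
     let N := closure (real_proj H @` imul_set S) in
     [/\ K `<=` H,
         cyclic_set K <->
           complex_span M `&` complex_span (symplectic_compl H) = [set 0],
         M = N &
         real_orth_dsum H K N].
Proof.
move=> sH [rS _] K M N; have [cH _ _] := sH; have [rH _] := cH.
have [[sH0 _] _] := symp_closed H.
have KE : K = H `&` orth (imul_set S).
  by rewrite /K symp_sum // ?symp_sympK ?symp_imulE //; case: rS.
have KH : K `<=` H by rewrite KE => x [].
have cK : closed_real_subspace K by exact: symp_closed.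
have MN : M = N.
  rewrite /M /N KE -orth_real_proj //; apply: relative_biorth => //.
    by apply: real_proj_image => //; exact: imul_subspace.
  by move=> _ [s _ <-]; case: (real_projP s cH).
split=> //; first exact: cyclic_subspaceP.
by rewrite -MN; exact: orth_decomp.
Qed.

End RealForm.

Theorem proposition4p6 (R : realType) (V : hilbertType R)
    (V_separable : separable_space V) (F Fhat : set V)
    (F_closed : closed_real_subspace F) (Fhat_closed : closed_real_subspace Fhat) :
  (forall K : set V, standard_subspace K ->
     let H := closure (sum_set K F) in
     let M := real_orth_compl (symplectic_compl H) `&` symplectic_compl K in
     let N := closure (real_proj (symplectic_compl K) @` imul_set F) in
     [/\ separating H <-> complex_span M `&` complex_span K = [set 0],
         M = N &
         real_orth_dsum (symplectic_compl K) (symplectic_compl H) N])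
  /\
  (forall H : set V, standard_subspace H ->
     let K := symplectic_compl (sum_set (symplectic_compl H) Fhat) in
     let M := real_orth_compl K `&` H in
     let N := closure (real_proj H @` imul_set Fhat) in
     [/\ K `<=` H,
         cyclic_set K <->
           complex_span M `&` complex_span (symplectic_compl H) = [set 0],
         M = N &
         real_orth_dsum H K N]).
Proof.
split=> [K sK H M N|H sH]; last exact: relative_symp_compl.
have [cK _ _] := sK; have [rK _] := cK; have [rF _] := F_closed.
have cH : closed_real_subspace H by apply: closure_subspace; exact: sum_subspace.
have := relative_symp_compl (symp_standard sK) F_closed.
rewrite /= (symp_sympK cK) -symp_closure -/H -/M -/N => -[_ cyc MN dsum].
split=> //; rewrite -cyc cyclic_symp ?symp_sympK //.
by case: (symp_closed H).
Qed.
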